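(* Let $S\subseteq\mathbb{N}^{\mathbb{N}}$. Then $S$ is $\boldsymbol{\Delta}^0_2$ if and only if there exists $T\subseteq\mathbb{N}^{\mathbb{N}}$ such that $S=T\setminus[T_{\infty}]$.
   Context: $\mathbb{N}^{\mathbb{N}}$ is Baire space (all functions $f:\mathbb{N}\to\mathbb{N}$, with the product topology of the discrete topology), and $\boldsymbol{\Delta}^0_2$ is the boldface Borel pointclass of subsets of $\mathbb{N}^{\mathbb{N}}$ that are both $F_\sigma$ and $G_\delta$. $\mathbb{N}^{<\mathbb{N}}$ is the set of finite sequences of natural numbers (including the empty sequence). For sequences $x,y$ (finite or infinite), $x\subseteq y$ means that $x$ is an initial segment of $y$. For $X\subseteq\mathbb{N}^{<\mathbb{N}}$, $[X]\subseteq\mathbb{N}^{\mathbb{N}}$ denotes the set of infinite sequences all of whose finite initial segments are in $X$. For $T\subseteq\mathbb{N}^{\mathbb{N}}$, define $T_{\alpha}\subseteq\mathbb{N}^{<\mathbb{N}}$ for every ordinal $\alpha$ by transfinite recursion: $T_0=\mathbb{N}^{<\mathbb{N}}$; $T_{\lambda}=\bigcap_{\beta<\lambda}T_{\beta}$ for every limit ordinal $\lambda$ (that is, $\lambda$ nonzero and not a successor); and for every ordinal $\beta$, $$T_{\beta+1}=\{x\in T_{\beta} : \text{there exist } x',x''\in[T_{\beta}] \text{ such that } x\subseteq x',\ x\subseteq x'',\ x'\in T,\ \text{and } x''\notin T\}.$$ Let $\alpha(T)$ be the least ordinal $\alpha$ such that $T_{\alpha}=T_{\alpha+1}$, and let $T_{\infty}=T_{\alpha(T)}$.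 *)

(* Defs.v *)
(* MathComp + MathComp-Analysis *)
From HB Require Import structures.
From mathcomp Require Import all_boot.
From mathcomp Require Import generic_quotient.
From mathcomp Require Import all_classical.
From mathcomp Require Import topology borel_hierarchy.

Set Implicit Arguments.
Unset Strict Implicit.
Unset Printing Implicit Defensive.

Local Open Scope classical_set_scope.
Local Open Scope quotient_scope.

(* The libraries have no ordinals.  A tree [Sup f] is a notation for the least
   ordinal strictly above all the [f x]; every ordinal of the universe of [A]
   has such a notation, and [Ord] is the quotient identifying the trees that
   denote the same ordinal. *)
Inductive otree : Type := Sup (A : Type) (f : A -> otree).

Fixpoint tle (a b : otree) {struct a} : Prop :=
  let: Sup A f := a in
  forall x : A, let: Sup B g := b in exists y : B, tle (f x) (g y).

Definition tlt (a b : otree) : Prop :=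
  let: Sup B g := b in exists y : B, tle a (g y).

Lemma tleE A (f : A -> otree) b : tle (Sup f) b <-> forall x, tlt (f x) b.
Proof. by case: b. Qed.

Lemma tle_refl a : tle a a.
Proof. by elim: a => A f IH x; exists x; apply: IH. Qed.

Lemma tle_trans a b c : tle a b -> tle b c -> tle a c.
Proof.
elim: a b c => A f IH [B g] [C h] ab bc x.
have [y xy] := ab x; have [z yz] := bc y.
by exists z; apply: IH xy yz.
Qed.

Lemma tle_lt_trans a b c : tle a b -> tlt b c -> tlt a c.
Proof. by case: c => C h ab [z bz]; exists z; apply: tle_trans bz. Qed.

Lemma tlt_le_trans a b c : tlt a b -> tle b c -> tlt a c.
Proof.
case: b c => B g [C h] [y ay] bc; have [z yz] := bc y.
by exists z; apply: tle_trans yz.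
Qed.

Lemma tltW a b : tlt a b -> tle a b.
Proof.
elim: a b => A f IH b ab; apply/tleE => x.
by apply: tle_lt_trans ab; apply: (IH x); exists x; apply: tle_refl.
Qed.

Lemma tle_or_lt a b : tle a b \/ tlt b a.
Proof.
elim: b a => B g IH a.
have [h|/existsNP[y nya]] := pselect (forall y, tlt (g y) a); last first.
  left; have [ay|//] := IH y a; case: a nya ay => A f nya ay.
  by apply: tltW; exists y.
case: a h => A f h.
have [[x fx]|nh] := pselect (exists x, tle (Sup g) (f x)).
  by right; exists x.
left; apply/tleE => x.
have [[y fxy]|nfx] := pselect (exists y, tle (f x) (g y)); first by exists y.
case: nh; exists x; apply/tleE => y.
by have [xy|//] := IH y (f x); case: nfx; exists y.
Qed.

Lemma tlt_acc a b : tle b a -> Acc tlt b.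
Proof.
elim: a b => A f IH b ba; constructor => c cb.
by have [x cx] := tlt_le_trans cb ba; apply: (IH x).
Qed.

Lemma tlt_wf : well_founded tlt.
Proof. by move=> a; apply: tlt_acc (tle_refl a). Qed.

HB.instance Definition _ := gen_eqMixin otree.
HB.instance Definition _ := gen_choiceMixin otree.

Definition teqv (a b : otree) : bool := `[< tle a b /\ tle b a >].

Lemma teqv_refl : reflexive teqv.
Proof. by move=> a; apply/asboolP; split; apply: tle_refl. Qed.

Lemma teqv_sym : symmetric teqv.
Proof. by move=> a b; apply/asboolP/asboolP => -[]. Qed.

Lemma teqv_trans : transitive teqv.
Proof.
move=> b a c /asboolP[ab ba] /asboolP[bc cb].
by apply/asboolP; split; [apply: tle_trans bc | apply: tle_trans ba].
Qed.

Canonical teqv_rel := EquivRel teqv teqv_refl teqv_sym teqv_trans.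

Definition Ord : Type := {eq_quot teqv_rel}.

Definition mkord (a : otree) : Ord := \pi_({eq_quot teqv_rel}) a.
Definition tree_of (a : Ord) : otree := repr (a : {eq_quot teqv_rel}).

Definition ole (a b : Ord) : Prop := tle (tree_of a) (tree_of b).
Definition olt (a b : Ord) : Prop := tlt (tree_of a) (tree_of b).

Definition ozero : Ord := mkord (Sup (fun x : void => match x with end)).
Definition osucc (a : Ord) : Ord := mkord (Sup (fun _ : unit => tree_of a)).

Definition is_limit (a : Ord) : Prop :=
  a <> ozero /\ ~ (exists b, a = osucc b).

Lemma tree_ofK a : tle (tree_of (mkord a)) a /\ tle a (tree_of (mkord a)).
Proof.
apply/asboolP; have /eqmodP : mkord (tree_of (mkord a)) = mkord a.
  by rewrite /mkord /tree_of reprK.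
exact.
Qed.

(* [Ord] is well-ordered, every small family has a strict supremum ([ord_sup])
   and every element arises in this way ([ord_is_sup]), so that [Ord] is the
   class of all ordinals of the universe of [A]; [osucc] is the successor. *)
Lemma ole_refl a : ole a a.
Proof. exact: tle_refl. Qed.

Lemma ole_anti a b : ole a b -> ole b a -> a = b.
Proof.
move=> ab ba; rewrite -[a]reprK -[b]reprK.
by apply/eqmodP/asboolP; split.
Qed.

Lemma ole_trans a b c : ole a b -> ole b c -> ole a c.
Proof. exact: tle_trans. Qed.

Lemma olt_wf : well_founded olt.
Proof.
suff h t : Acc tlt t -> forall a, tree_of a = t -> Acc olt a.
  by move=> a; apply: (h _ (tlt_wf _) a).
elim=> {}t _ IH a et; constructor => b ba.
by apply: (IH (tree_of b)) => //; rewrite -et.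
Qed.

Lemma ole_or_lt a b : ole a b \/ olt b a.
Proof. exact: tle_or_lt. Qed.

Lemma olt_irr a : ~ olt a a.
Proof. by elim/(well_founded_ind olt_wf): a => a IH aa; apply: (IH a aa). Qed.

Lemma olt_le_trans a b c : olt a b -> ole b c -> olt a c.
Proof. exact: tlt_le_trans. Qed.

Lemma ole_lt_trans a b c : ole a b -> olt b c -> olt a c.
Proof. exact: tle_lt_trans. Qed.

Lemma oltW a b : olt a b -> ole a b.
Proof. exact: tltW. Qed.

Lemma ole_zero a : ole ozero a.
Proof. by apply: tle_trans (tree_ofK _).1 _; apply/tleE; case. Qed.

Lemma olt_succP a b : olt b (osucc a) <-> ole b a.
Proof.
have [h1 h2] := tree_ofK (Sup (fun _ : unit => tree_of a)).
split=> [h|h]; first by have [] := tlt_le_trans h h1.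
by apply: tlt_le_trans h2; exists tt.
Qed.

Lemma ord_sup (A : Type) (f : A -> Ord) :
  exists s : Ord, (forall x, olt (f x) s) /\
    (forall b, (forall x, olt (f x) b) -> ole s b).
Proof.
set t := Sup (fun x => tree_of (f x)); have [h1 h2] := tree_ofK t.
exists (mkord t); split=> [x|b fb].
  by apply: tlt_le_trans h2; exists x; apply: tle_refl.
by apply: tle_trans h1 _; apply/tleE.
Qed.

Lemma ord_is_sup (a : Ord) : exists (A : Type) (f : A -> Ord),
  (forall x, olt (f x) a) /\ (forall b, (forall x, olt (f x) b) -> ole a b).
Proof.
case e : (tree_of a) => [A f]; exists A, (fun x => mkord (f x)).
split=> [x|b fb]; last first.
  rewrite /ole e; apply/tleE => x.
  by apply: tle_lt_trans (fb x); apply: (tree_ofK _).2.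
by rewrite /olt e; exists x; apply: (tree_ofK _).1.
Qed.

Lemma olt_succ_eq a b : a = osucc b -> olt b a.
Proof. by move=> ->; apply/olt_succP/ole_refl. Qed.

Lemma osucc_inj : injective osucc.
Proof.
by move=> a b e; apply: ole_anti; apply/olt_succP; apply: olt_succ_eq.
Qed.

Definition least (P : Ord -> Prop) (a : Ord) : Prop :=
  P a /\ forall b, P b -> ole a b.

Lemma least_exists (P : Ord -> Prop) : (exists a, P a) -> exists a, least P a.
Proof.
case=> a; elim/(well_founded_ind olt_wf): a => a IH Pa.
have [[b [ba Pb]]|nh] := pselect (exists b, olt b a /\ P b); first exact: (IH b).
exists a; split=> // b Pb; have [//|ba] := ole_or_lt a b.
by case: nh; exists b.
Qed.

Definition baire : Type := prod_topology (fun _ : nat => nat).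
HB.instance Definition _ := Topological.on baire.

Definition Delta02 (S : set baire) : Prop := Fsigma S /\ Gdelta S.

(* The finite sequence [s] is an initial segment of [x]. *)
Definition initseg (s : seq nat) (x : baire) : Prop := mkseq x (size s) = s.

Definition branches (X : set (seq nat)) : set baire :=
  [set x | forall s, initseg s x -> X s].

Definition deriv (T : set baire) (X : set (seq nat)) : set (seq nat) :=
  [set s | X s /\ exists x' x'' : baire,
     [/\ branches X x', branches X x'', initseg s x' & initseg s x''] /\
     (T x' /\ ~ T x'')].

(* When [a] is zero both clauses are void, so that the stage is the full set;
   see [stage0], [stage_limit] and [stage_succ]. *)
Definition stage_step (T : set baire) (a : Ord)
    (rec : forall b, olt b a -> set (seq nat)) : set (seq nat) :=
  [set s | (is_limit a -> forall b (h : olt b a), rec b h s) /\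
           (forall b (e : a = osucc b), deriv T (rec b (olt_succ_eq e)) s)].

Definition stage (T : set baire) : Ord -> set (seq nat) :=
  Fix olt_wf (fun _ => set (seq nat)) (@stage_step T).

Lemma stageE T a : stage T a = @stage_step T a (fun b _ => stage T b).
Proof.
rewrite /stage Fix_eq // => {}a f g fg.
by congr stage_step; apply/functional_extensionality_dep => b; apply/funext.
Qed.

Lemma stage0 T : stage T ozero = setT.
Proof.
rewrite stageE; apply/seteqP; split=> // s _; split=> [[]//|b e].
by have [] := @olt_irr b; apply: olt_le_trans (olt_succ_eq e) (ole_zero b).
Qed.

Lemma stage_limit T a : is_limit a ->
  stage T a = \bigcap_(b in [set b | olt b a]) stage T b.
Proof.
move=> la; rewrite stageE; apply/seteqP; split=> s.
  by case=> /(_ la) h _ b; apply: h.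
by move=> h; split=> [_ b|b e]; [apply: h | case: la.2; exists b].
Qed.

Lemma stage_succ T b : stage T (osucc b) = deriv T (stage T b).
Proof.
rewrite stageE; apply/seteqP; split=> s; first by case=> _; apply.
by move=> h; split=> [[_]|c /osucc_inj <- //]; case; exists b.
Qed.

Lemma stage_le T a b : ole a b -> stage T b `<=` stage T a.
Proof.
elim/(well_founded_ind olt_wf): b => b IH ab.
have [ba|ab'] := ole_or_lt b a; first by rewrite (ole_anti ab ba).
have [[c e]|nb] := pselect (exists c, b = osucc c).
  rewrite e stage_succ => s [cs _]; apply: (IH c _ _ s cs).
    exact: olt_succ_eq e.
  by apply/olt_succP; rewrite -e.
rewrite stage_limit => [s|]; first exact.
by split=> // e; apply: (@olt_irr a); apply: olt_le_trans ab' _; rewrite e;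
  apply: ole_zero.
Qed.

Definition stable (T : set baire) (a : Ord) : Prop :=
  stage T a = stage T (osucc a).

Lemma stable_exists T : exists a, stable T a.
Proof.
have /choice[r rP] s : exists a, (exists b, ~ stage T b s) -> ~ stage T a s.
  by have [[b nb]|nb] := pselect (exists b, ~ stage T b s);
    [exists b | exists ozero].
have [a [ar _]] := ord_sup r; exists a.
apply/seteqP; split=> s; last by rewrite stage_succ => -[].
move=> sa; apply: contrapT => ns.
by apply: (rP s); [exists (osucc a) | apply: stage_le sa; apply: oltW].
Qed.

Definition alpha (T : set baire) : Ord :=
  sval (cid (least_exists (stable_exists T))).

Lemma alphaP T : least (stable T) (alpha T).
Proof. exact: (svalP (cid _)). Qed.

Definition stage_infty (T : set baire) : set (seq nat) := stage T (alpha T).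

(* Main.v *)
Require Import Defs.
From mathcomp Require Import all_boot all_classical.
From mathcomp Require Import topology borel_hierarchy.
Local Open Scope classical_set_scope.

(* A set [S] and its complement that are both G_delta cannot both be dense in a
   nonempty closed set, by the Baire category argument; hence [T := S] works,
   with [branches (stage_infty S)] empty.  Conversely, a branch that leaves the
   stages does so at a successor stage, through a node [s] leaving there as
   well; among the branches through [s] that survive as long as [s] does,
   membership in [T] is constant.  The union of these countably many closed sets is
   the complement of [branches (stage_infty T)], so [T `\` branches
   (stage_infty T)] and its complement are both F_sigma. *)

Lemma initseg_mkseq (x : baire) (n : nat) : initseg (mkseq x n) x.
Proof. by rewrite /initseg size_mkseq. Qed.

Lemma initseg_mkseqP (x y : baire) (n : nat) :
  initseg (mkseq x n) y <-> forall i, i < n -> y i = x i.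
Proof.
rewrite /initseg size_mkseq; split=> [e i ilt|xy].
  by have := congr1 (nth 0 ^~ i) e; rewrite !nth_mkseq.
by apply/eq_in_map => i; rewrite mem_iota => /xy.
Qed.

(** Cylinders form a neighbourhood basis: convergence in the product topology is checked
    coordinatewise, and a cylinder is a finite intersection of preimages of points, each open since
    [nat] is discrete. *)
Lemma nbhs_baireP (x : baire) (U : set baire) :
  nbhs x U <-> exists n, initseg (mkseq x n) `<=` U.
Proof.
split=> [xU|[n nU]].
  pose F := filter_from setT (fun n => initseg (mkseq x n)).
  have FF : Filter F.
    apply: filter_from_filter => [|m n _ _]; first by exists 0.
    exists (maxn m n) => // y /initseg_mkseqP xy.
    by split; apply/initseg_mkseqP => i ilt; apply: xy;
      rewrite leq_max ilt ?orbT.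
  suff /(_ U xU)[n _ nU] : F --> x by exists n.
  apply/cvg_sup => i V [_ [[W oW <-] Wx WV]].
  exists i.+1 => // y /initseg_mkseqP xy; apply: WV => /=.
  by rewrite xy.
apply: (filterS nU); elim: n {nU} => [|n IH]; first exact: filterE.
have nx : nbhs x [set y : baire | y n = x n].
  have := @proj_continuous nat (fun=> nat) n x [set x n]; apply.
  exact: discrete_set1.
apply: filterS (filterI IH nx) => y [/initseg_mkseqP xy yn].
apply/initseg_mkseqP => i; rewrite ltnS leq_eqVlt => /orP[/eqP -> //|].
exact: xy.
Qed.

Lemma closed_initseg (s : seq nat) : closed (initseg s).
Proof.
move=> x clx.
have /nbhs_baireP/clx[y [ys]] :
    exists n, initseg (mkseq x n) `<=` initseg (mkseq x (size s)).
  by exists (size s).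
by rewrite /initseg size_mkseq => <-.
Qed.

Lemma closed_branches (X : set (seq nat)) : closed (branches X).
Proof.
move=> x clx s sx.
have /nbhs_baireP/clx[y [yX]] : exists n, initseg (mkseq x n) `<=` initseg s.
  by exists (size s); rewrite sx.
exact: yX.
Qed.

Lemma branchesS (X Y : set (seq nat)) : X `<=` Y -> branches X `<=` branches Y.
Proof. by move=> XY x xX s sx; apply/XY/xX. Qed.

Lemma derivS (T : set baire) (X Y : set (seq nat)) :
  X `<=` Y -> deriv T X `<=` deriv T Y.
Proof.
move=> XY s [Xs [x [y [[xX yX sx sy] xy]]]]; split; first exact: XY.
by exists x, y; split=> //; split=> //; apply: branchesS XY _ _.
Qed.

Lemma stage_infty_fix (T : set baire) :
  deriv T (stage_infty T) = stage_infty T.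
Proof. by rewrite -stage_succ -(alphaP T).1. Qed.

(** Since [deriv] is monotone, a fixed point passes through every successor step, also past
    [alpha T], where [stage_le] only gives the opposite inclusion. *)
Lemma stage_infty_sub (T : set baire) (a : Ord) : stage_infty T `<=` stage T a.
Proof.
elim/(well_founded_ind olt_wf): a => a IH.
have [->|a0] := pselect (a = ozero); first by rewrite stage0.
have [[b e]|nb] := pselect (exists b, a = osucc b).
  rewrite e stage_succ -stage_infty_fix.
  by apply: derivS; apply: IH; apply: olt_succ_eq e.
by rewrite stage_limit// => s sT b ba; apply: IH ba s sT.
Qed.

(** The least stage not including [E] is neither stage zero nor a limit stage, the latter being an
    intersection of stages that include [E]. This is applied to a single node and to all initial
    segments of a branch. *)
Lemma stage_exit (T : set baire) (E : set (seq nat)) :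
  ~ E `<=` stage_infty T ->
  exists b, E `<=` stage T b /\ ~ E `<=` stage T (osucc b).
Proof.
move=> ET; have [|c [nc minc]] := @least_exists (fun c => ~ E `<=` stage T c).
  by exists (alpha T).
have Eb b : olt b c -> E `<=` stage T b.
  move=> bc; apply: contrapT => /minc cb.
  by apply: (@olt_irr b); apply: olt_le_trans bc cb.
have [c0|c0] := pselect (c = ozero); first by case: nc; rewrite c0 stage0.
have [[b e]|nb] := pselect (exists b, c = osucc b).
  by exists b; split; [apply/Eb/olt_succ_eq | rewrite -e].
by case: nc; rewrite stage_limit// => s Es b bc; apply: Eb bc s Es.
Qed.

Lemma Gdelta_setC (X : topologicalType) (S : set X) :
  Gdelta (~` S) <-> Fsigma S.
Proof.
split=> -[F oF FE]; exists (fun n => ~` F n).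
- by move=> n; rewrite closedC.
- by rewrite -setC_bigcap -FE setCK.
- by move=> n; rewrite openC.
- by rewrite -setC_bigcup -FE.
Qed.

Lemma countable_bigcup_Fsigma (I : countType) (X : topologicalType) (D : set I)
    (A : I -> set X) :
  (forall s, closed (A s)) -> Fsigma (\bigcup_(s in D) A s).
Proof.
move=> cA; exists (fun n => if unpickle n is Some s then
    if `[< D s >] then A s else set0 else set0).
  move=> n; case: unpickle => [s|]; last exact: closed0.
  by case: ifP => // _; exact: closed0.
apply/seteqP; split=> x.
  case=> s Ds As; exists (pickle s) => //=; rewrite pickleK.
  by case: asboolP.
case=> n _ /=; case: unpickle => [s|//].
by case: asboolP => // Ds As; exists s.
Qed.

Lemma closedU_Fsigma (X : topologicalType) (A B : set X) :
  closed A -> Fsigma B -> Fsigma (A `|` B).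
Proof.
move=> cA [F cF ->]; exists (fun n => A `|` F n).
  by move=> n; apply: closedU.
apply/seteqP; split=> x.
  by case=> [Ax|[n _ Fx]]; [exists 0 => //; left | exists n => //; right].
by case=> n _ [Ax|Fx]; [left | right; exists n].
Qed.

(** Quantifying over all stages that contain [s] avoids naming the last one and exhibits the set as
    an intersection of closed sets. *)
Definition survivors (T : set baire) (s : seq nat) : set baire :=
  [set x | initseg s x /\ forall b, stage T b s -> branches (stage T b) x].

Lemma closed_survivors (T : set baire) (s : seq nat) : closed (survivors T s).
Proof.
have -> : survivors T s =
    initseg s `&` \bigcap_(b in [set b | stage T b s]) branches (stage T b).
  by [].
apply: closedI; first exact: closed_initseg.
by apply: closed_bigI => b _; apply: closed_branches.
Qed.

(** At the last stage [b] containing [s], both points are branches; on opposite sides of [T] they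
    would witness that [s] survives to stage [osucc b]. *)
Lemma survivors_same_side (T : set baire) (s : seq nat) (x y : baire) :
  ~ stage_infty T s -> survivors T s x -> survivors T s y -> T x -> T y.
Proof.
move=> sT [sx xs] [sy ys] Tx; apply: contrapT => Ty.
have [|b [sb nsb]] := @stage_exit T [set s].
  by move=> /(_ s erefl).
have {}sb := sb s erefl; apply: nsb => _ ->.
rewrite stage_succ; split=> //; exists x, y; split=> //.
by split=> //; [apply: xs | apply: ys].
Qed.

Lemma survivors_cover (T : set baire) (x : baire) :
  ~ branches (stage_infty T) x <->
  exists2 s, ~ stage_infty T s & survivors T s x.
Proof.
split=> [xT|[s sT [sx _]]]; last by move=> /(_ s sx).
have [|b [xb /existsNP[s /not_implyP[sx nsb]]]] :=
  @stage_exit T [set s | initseg s x] => //.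
(* A stage [d] containing [s] satisfies [d <= b], as later stages lie inside stage [osucc b], which
   [s] has left; and [x] is a branch of every stage up to [b]. *)
exists s => [/stage_infty_sub//|]; split=> // d sd.
have [db|bd] := ole_or_lt d b.
  by apply: branchesS xb; apply: stage_le.
case: nsb; apply: stage_le sd.
have [//|] := ole_or_lt (osucc b) d.
by move=> /olt_succP db; case: (@olt_irr d); apply: ole_lt_trans db bd.
Qed.

Lemma Delta02_setD_branches (T : set baire) :
  Delta02 (T `\` branches (stage_infty T)).
Proof.
pose D := [set s | ~ stage_infty T s].
split.
  (* By [survivors_same_side], each piece either lies inside [T] or misses it; here the pieces
     inside are collected, below those outside. *)
  have -> : T `\` branches (stage_infty T) =
      \bigcup_(s in D `&` [set s | survivors T s `<=` T]) survivors T s.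
    apply/seteqP; split=> x.
      move=> [Tx /survivors_cover[s sT xs]]; exists s => //; split=> // y ys.
      exact: survivors_same_side sT xs ys Tx.
    move=> [s [sT sub] xs]; split; first exact: sub.
    by apply/survivors_cover; exists s.
  exact/countable_bigcup_Fsigma/closed_survivors.
rewrite -[X in Gdelta X]setCK; apply/Gdelta_setC.
have -> : ~` (T `\` branches (stage_infty T)) = branches (stage_infty T) `|`
    \bigcup_(s in D `&` [set s | survivors T s `<=` ~` T]) survivors T s.
  apply/seteqP; split=> x.
    have [xT _|xT nx] := pselect (branches (stage_infty T) x); first by left.
    right; have /survivors_cover[s sT xs] := xT.
    exists s => //; split=> // y ys Ty.
    by apply: nx; split=> //; apply: survivors_same_side sT ys xs Ty.
  by move=> [xT [_ /(_ xT)]|[s [sT sub] /sub nTx] []].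
apply: closedU_Fsigma; first exact: closed_branches.
exact/countable_bigcup_Fsigma/closed_survivors.
Qed.

Lemma seq_chain_limit (s : nat -> seq nat) :
  (forall n, prefix (s n) (s n.+1)) -> (forall n, size (s n) < size (s n.+1)) ->
  exists x : baire, forall n, initseg (s n) x.
Proof.
move=> pre ssz; have szn n : n <= size (s n).
  by elim: n => // n IH; apply: leq_ltn_trans IH (ssz n).
have prem m n : m <= n -> prefix (s m) (s n).
  move=> /subnK <-; elim: (n - m) => [|k IH]; first exact: prefix_refl.
  exact: prefix_trans IH (pre _).
have nthE m n i : i < size (s m) -> m <= n -> nth 0 (s n) i = nth 0 (s m) i.
  by move=> im /prem/prefixP[t ->]; rewrite nth_cat im.
(* By [szn], [s i.+1] has more than [i] entries, so the default 0 is never read. *)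
exists (fun i => nth 0 (s i.+1) i) => n.
apply: (@eq_from_nth _ 0) => [|i]; rewrite size_mkseq// => isz.
rewrite nth_mkseq//; have [ni|/ltnW ni] := leqP n i.+1; first exact: nthE.
by rewrite -(@nthE i.+1 n)// szn.
Qed.

(** Starting from any node of [X], step [n] extends the current node inside [X] until its cylinder
    lies in [U n]; the limit of the nodes lies in every [U n]. *)
Lemma baire_category (X : set (seq nat)) (U : nat -> set baire) :
  X !=set0 -> (forall n, open (U n)) ->
  (forall n s, X s -> initseg s `&` branches X `&` U n !=set0) ->
  \bigcap_n U n !=set0.
Proof.
move=> [s0 Xs0] oU dU.
have /choice[g gP] (ns : nat * seq nat) : exists t, X ns.2 ->
    [/\ X t, prefix ns.2 t, size ns.2 < size t & initseg t `<=` U ns.1].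
  have [Xs|//] := pselect (X ns.2); last by exists [::].
  have [x [[sx xX] Ux]] := dU ns.1 _ Xs.
  have /nbhs_baireP[m mU] : nbhs x (U ns.1) by apply: open_nbhs_nbhs.
  (* Length [m] puts the cylinder inside [U]; the other bound makes the extension strict. *)
  pose k := maxn m (size ns.2).+1.
  exists (mkseq x k) => _; split.
  - exact/xX/initseg_mkseq.
  - rewrite prefixE /mkseq -map_take take_iota.
    by rewrite (minn_idPl (ltnW (leq_maxr _ _))); apply/eqP.
  - by rewrite size_mkseq leq_maxr.
  - move=> y ky; apply: mU; apply/initseg_mkseqP => i im.
    by move/initseg_mkseqP: ky; apply; rewrite leq_max im.
pose s := fix s n := if n is n'.+1 then g (n', s n') else s0.
have Xs n : X (s n) by elim: n => //= n IH; have [] := gP (n, s n) IH.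
have [||x xs] := @seq_chain_limit s.
- by move=> n; have [] := gP (n, s n) (Xs n).
- by move=> n; have [] := gP (n, s n) (Xs n).
exists x => n _; have [_ _ _] := gP (n, s n) (Xs n); apply.
exact: (xs n.+1).
Qed.

Lemma Delta02_branches_stage_infty (S : set baire) :
  Delta02 S -> branches (stage_infty S) = set0.
Proof.
move=> [[F cF SF] [G oG SG]]; rewrite -subset0 => x xS.
(* Odd indices intersect to [S] and even ones to its complement, so a common point is
   contradictory. *)
pose U n := if odd n then G n./2 else ~` F n./2.
have [|n|n s|y yU] := @baire_category (stage_infty S) U.
- by exists [::]; apply: xS.
- by rewrite /U; case: odd => //; apply: closed_openC.
(* A node of the fixed point has a branch in [S], hence in every [G n], and one outside [S], hence
   in no [F n]. *)
- rewrite -{1}stage_infty_fix => -[_ [y [z [[yS zS sy sz] [Sy Sz]]]]].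
  rewrite /U; case: odd; [exists y|exists z]; split=> //.
    by move: Sy; rewrite SG; apply.
  by move=> Fz; apply: Sz; rewrite SF; exists n./2.
have Sy : S y.
  rewrite SG => n _; have := yU n.*2.+1 I.
  by rewrite /U /= odd_double uphalf_double.
move: (Sy); rewrite SF => -[n _].
by have := yU n.*2 I; rewrite /U odd_double doubleK.
Qed.

Theorem theorem10 (S : set baire) :
  Delta02 S <-> exists T : set baire, S = T `\` branches (stage_infty T).
Proof.
split=> [dS|[T ->]]; last exact: Delta02_setD_branches.
by exists S; rewrite Delta02_branches_stage_infty// setD0.
Qed.
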